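(* Let $N\ge1$ be an integer and let $A^{[0]}$ be the $(N+1)\times(N+1)$ real matrix, indexed by $k,\ell\in\{0,\ldots,N\}$, with $A^{[0]}_{\ell,\ell}=-N$, $A^{[0]}_{\ell-1,\ell}=\ell$, $A^{[0]}_{\ell+1,\ell}=N-\ell$, and all other entries zero. Then the spectrum of $A^{[0]}$ is $$\{-2r : r=0,1,\ldots,N\}.$$ Moreover, for each $r=0,\ldots,N$, an (unnormalised) eigenvector $v=(v_0,\ldots,v_N)^\top$ corresponding to the eigenvalue $-2r$ is given by $$v_m=(-1)^m\binom{r}{m}\,{}_2F_1(-N+r,-m;\,r-m+1;\,-1),\qquad m=0,\ldots,r,$$ $$v_m=(-1)^r\binom{N-r}{m-r}\,{}_2F_1(-N+m,-r;\,m-r+1;\,-1),\qquad m=r,\ldots,N.$$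
   Context: ${}_2F_1(a,b;c;z)=\sum_{k\ge0}\frac{(a)_k(b)_k}{(c)_k\,k!}z^k$ is the hypergeometric function, with $(a)_k=a(a+1)\cdots(a+k-1)$ the Pochhammer symbol; here all the series terminate. *)

(* Defs.v *)
From mathcomp Require Import all_boot all_order all_algebra.
From mathcomp Require Import all_classical all_reals all_analysis.
From mathcomp Require Import complex.

Set Implicit Arguments.
Unset Strict Implicit.
Unset Printing Implicit Defensive.

Import Order.TTheory GRing.Theory Num.Theory.
Import numFieldNormedType.Exports.

Local Open Scope classical_set_scope.
Local Open Scope ring_scope.

Definition pochhammer (R : realType) (a : R) (k : nat) : R :=
  \prod_(i < k) (a + i%:R).

(* Division by zero yields zero, so this is meaningful only when
   [pochhammer c k] vanishes for no [k], i.e. when [c] is not a nonpositive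
   integer. The limit is the usual sum whenever the series converges, in
   particular when [a] or [b] is a nonpositive integer (terminating series). *)
Definition hyp2F1 (R : realType) (a b c z : R) : R :=
  limn (series (fun k : nat =>
    pochhammer a k * pochhammer b k / (pochhammer c k * k`!%:R) * z ^+ k)).

(* The second branch is the superdiagonal entry A_(l-1,l), the third one the
   subdiagonal entry A_(l+1,l). *)
Definition A0 (R : realType) (N : nat) : 'M[R]_N.+1 :=
  \matrix_(k < N.+1, l < N.+1)
    (if (k : nat) == l then - N%:R
     else if k.+1 == l then (l : nat)%:R
     else if (k : nat) == l.+1 then N%:R - (l : nat)%:R
     else 0).

(* [eigenvalue] refers to row vectors (v *m A = a *: v); the set of eigenvalues
   of a square matrix over a field is the same for row and column vectors. *)
Definition spectrum (F : fieldType) (n : nat) (A : 'M[F]_n) : set F :=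
  [set a : F | eigenvalue A a].

(* Main.v *)
Require Import Defs.
From mathcomp Require Import all_boot all_order all_algebra.
From mathcomp Require Import all_classical all_reals all_analysis.
From mathcomp Require Import complex.
From mathcomp Require Import ring zify.

Set Implicit Arguments.
Unset Strict Implicit.
Unset Printing Implicit Defensive.

Import Order.TTheory GRing.Theory Num.Theory.
Import numFieldNormedType.Exports.

Local Open Scope classical_set_scope.
Local Open Scope ring_scope.

(** Encode a vector v as the polynomial p = \sum_i v_i X^i. The matrix then acts
    as p |-> (1 - X^2) p' + N (X - 1) p on polynomials of degree at most N, and
    (1 - X)^r (1 + X)^(N - r) is an eigenfunction for -2r. These N + 1 distinct
    eigenvalues exhaust the spectrum. Expanding the second factor of the
    eigenfunction by the binomial theorem when m <= r, and the first one when
    r <= m, matches the coefficient of X^m term by term with the terminating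
    hypergeometric series. *)

(** * Eigenvalues of a square matrix *)

Lemma char_poly_tr (R : comNzRingType) (n : nat) (A : 'M[R]_n) :
  char_poly A^T = char_poly A.
Proof.
rewrite /char_poly -[RHS]det_tr; congr (\det _).
by apply/matrixP => i j; rewrite !mxE eq_sym.
Qed.

(** [eigenvalue] speaks of row vectors; [A] and its transpose share their characteristic polynomial,
    hence their eigenvalues. *)
Lemma eigenvalue_col (F : fieldType) (n : nat) (A : 'M[F]_n) (a : F)
    (v : 'cV[F]_n) :
  v != 0 -> A *m v = a *: v -> eigenvalue A a.
Proof.
move=> v0 Av; rewrite eigenvalue_root_char -char_poly_tr -eigenvalue_root_char.
apply/eigenvalueP; exists v^T; first by rewrite -trmx_mul Av linearZ.
by apply: contra_neq v0 => v0; rewrite -[v]trmxK v0 trmx0.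
Qed.

(** The characteristic polynomial is monic of degree n, so n distinct roots split it completely and
    leave no room for another. *)
Lemma eigenvalue_uniq_seq (F : fieldType) (n : nat) (A : 'M[F]_n) (s : seq F) :
  size s = n -> uniq s -> all (eigenvalue A) s -> eigenvalue A =1 mem s.
Proof.
move=> sz us /allP ev a; rewrite eigenvalue_root_char.
rewrite (@all_roots_prod_XsubC _ (char_poly A) s).
- by rewrite (monicP (char_poly_monic A)) scale1r root_prod_XsubC.
- by rewrite size_char_poly sz.
- by apply/allP => x /ev; rewrite eigenvalue_root_char.
- by rewrite uniq_rootsE.
Qed.

(** * Terminating hypergeometric series *)

Lemma limn_series_finite (R : realType) (u : nat -> R) (n : nat) :
  (forall k, (n <= k)%N -> u k = 0) -> limn (series u) = \sum_(k < n) u k.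
Proof.
move=> u0; apply: lim_near_cst; first exact: norm_hausdorff.
exists n => // m /= nm.
rewrite /series /= (big_cat_nat (leq0n n) nm) /= big_mkord.
rewrite [X in _ + X]big_nat_cond.
by rewrite [X in _ + X]big1 ?addr0// => k /andP[/andP[nk _] _]; exact: u0.
Qed.

Lemma pochhammerS (R : realType) (a : R) (k : nat) :
  pochhammer a k.+1 = pochhammer a k * (a + k%:R).
Proof. by rewrite /pochhammer big_ord_recr. Qed.

Lemma pochhammerN (R : realType) (n k : nat) :
  pochhammer (- n%:R : R) k = (-1) ^+ k * (n ^_ k)%:R.
Proof.
elim: k => [|k IH]; first by rewrite /pochhammer big_ord0 expr0 ffactn0 mulr1.
rewrite pochhammerS IH ffactnSr natrM exprS.
(* Truncated subtraction n - k is the true difference only for k <= n; beyond that n ^_ k is already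
   0. *)
have [kn|nk] := leqP k n; first by rewrite natrB//; ring.
by rewrite ffact_small// !(mulr0, mul0r).
Qed.

Lemma pochhammer_nat (R : realType) (c k : nat) :
  pochhammer (c%:R + 1 : R) k * c`!%:R = (c + k)`!%:R.
Proof.
elim: k => [|k IH]; first by rewrite /pochhammer big_ord0 mul1r addn0.
rewrite pochhammerS addnS factS natrM -IH -natr1 natrD; ring.
Qed.

Lemma ffactnD (n i j : nat) : (n ^_ (i + j) = n ^_ i * (n - i) ^_ j)%N.
Proof.
elim: j => [|j IH]; first by rewrite addn0 ffactn0 muln1.
by rewrite addnS !ffactnSr IH subnDA mulnA.
Qed.

(** The binomial prefactor absorbs the quotient of n ^_ k by (c+1)_k. Three signs (-1)^k, from
    (-n)_k, (-p)_k and the argument -1, leave a single one. *)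
Lemma hyp2F1_term (R : realType) (n p c k : nat) :
  'C(n + c, c)%:R * (pochhammer (- n%:R : R) k * pochhammer (- p%:R) k /
    (pochhammer (c%:R + 1) k * k`!%:R) * (-1) ^+ k) =
  (-1) ^+ k * 'C(p, k)%:R * 'C(n + c, c + k)%:R.
Proof.
have fact0 m : (m`!)%:R != 0 :> R by rewrite pnatr_eq0 -lt0n fact_gt0.
have P0 : pochhammer (c%:R + 1 : R) k != 0.
  have := fact0 (c + k)%N; rewrite -pochhammer_nat mulf_eq0 negb_or.
  by case/andP.
(* Multiplied by c!, both sides become the falling factorial of n + c of length c + k. *)
have key : 'C(n + c, c)%:R * (n ^_ k)%:R =
    'C(n + c, c + k)%:R * pochhammer (c%:R + 1 : R) k.
  apply: (mulIf (fact0 c)); rewrite -[RHS]mulrA pochhammer_nat -!natrM.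
  by rewrite mulnAC !bin_ffact ffactnD addnK.
rewrite !pochhammerN -(bin_ffact p k) natrM.
transitivity (((-1) ^+ k) ^+ 2 * (-1) ^+ k * 'C(p, k)%:R *
   ('C(n + c, c)%:R * (n ^_ k)%:R) / pochhammer (c%:R + 1 : R) k).
  by field; rewrite P0 fact0.
by rewrite key sqrr_sign mul1r; field.
Qed.

Lemma bin_hyp2F1 (R : realType) (n p c : nat) :
  'C(n + c, c)%:R * hyp2F1 (- n%:R : R) (- p%:R) (c%:R + 1) (-1) =
  \sum_(k < p.+1) (-1) ^+ k * 'C(p, k)%:R * 'C(n + c, c + k)%:R.
Proof.
rewrite /hyp2F1 (@limn_series_finite _ _ p.+1) => [|k pk].
  by rewrite big_distrr; apply: eq_bigr => k _; exact: hyp2F1_term.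
by rewrite (pochhammerN _ p) ffact_small// !(mulr0, mul0r).
Qed.

(** Needed for m <= r, where the parameter bounding the sum, -(N - r), comes first. *)
Lemma hyp2F1C (R : realType) (a b c z : R) : hyp2F1 a b c z = hyp2F1 b a c z.
Proof.
rewrite /hyp2F1; congr (limn (series _)).
by apply/funext => k; rewrite [pochhammer a k * _]mulrC.
Qed.

(** * Eigenfunctions and their coefficients *)

(** For r <= N, the generating function in m of the binary Krawtchouk polynomials K_m(r). *)
Definition krawtchouk_poly (R : realType) (N r : nat) : {poly R} :=
  (1 - 'X) ^+ r * (1 + 'X) ^+ (N - r).

Lemma size_krawtchouk_poly (R : realType) (N r : nat) :
  (r <= N)%N -> (size (krawtchouk_poly R N r) <= N.+1)%N.
Proof.
move=> rN; have sz : size (1 - 'X : {poly R}) = 2%N.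
  by rewrite -size_polyN opprB size_XsubC.
have sz' : size (1 + 'X : {poly R}) = 2%N by rewrite addrC size_XaddC.
have := size_poly_exp_leq (1 - 'X : {poly R}) r; rewrite sz mul1n => h1.
have := size_poly_exp_leq (1 + 'X : {poly R}) (N - r); rewrite sz' mul1n => h2.
apply: leq_trans (size_polyMleq _ _) _.
by move: h1 h2; move: (size _) (size _); lia.
Qed.

(** The extra factor p avoids the exponent n - 1, so n = 0 needs no exception later. *)
Lemma deriv_exp_mul (R : comNzRingType) (p : {poly R}) (n : nat) :
  p * (p ^+ n)^`() = n%:R * p^`() * p ^+ n.
Proof.
case: n => [|n]; first by rewrite expr0 derivC mulr0 !mul0r.
by rewrite deriv_exp /= exprS -mulr_natl; ring.
Qed.

Lemma krawtchouk_poly_ode (R : realType) (N r : nat) : (r <= N)%N ->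
  (1 - 'X^2) * (krawtchouk_poly R N r)^`() +
    N%:R * ('X - 1) * krawtchouk_poly R N r =
  - (2%:R * r%:R) * krawtchouk_poly R N r.
Proof.
move=> rN; rewrite /krawtchouk_poly derivM.
have h1 := deriv_exp_mul (1 - 'X : {poly R}) r.
have h2 := deriv_exp_mul (1 + 'X : {poly R}) (N - r).
rewrite derivB derivX derivC in h1; rewrite derivD derivX derivC in h2.
(* Splitting 1 - X^2 as (1 - X)(1 + X) gives each derivative its own base. What remains is -r(1 + X)
   + (N - r)(1 - X) + N(X - 1) = -2r. *)
transitivity (((1 - 'X) * ((1 - 'X) ^+ r)^`())
    * ((1 + 'X) * (1 + 'X) ^+ (N - r))
  + ((1 - 'X) * (1 - 'X) ^+ r) * ((1 + 'X) * ((1 + 'X) ^+ (N - r))^`())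
  + N%:R * ('X - 1) * ((1 - 'X) ^+ r * (1 + 'X) ^+ (N - r)) : {poly R}).
  by ring.
rewrite h1 h2 natrB//; ring.
Qed.

Lemma coef_1DcX_exp (R : comNzRingType) (c : R) (n i : nat) :
  ((1 + c *: 'X) ^+ n)`_i = c ^+ i * 'C(n, i)%:R.
Proof.
rewrite exprDn coef_sum.
under eq_bigr => j _ do rewrite expr1n mul1r coefMn exprZn coefZ coefXn.
have [ni|ni] := leqP i n.
  rewrite (bigD1 (Ordinal (ni : (i < n.+1)%N)))//= eqxx mulr1 mulr_natr.
  rewrite big1 ?addr0// => j; rewrite -val_eqE /= eq_sym => /negPf->.
  by rewrite mulr0 mul0rn.
rewrite bin_small// mulr0 big1// => j _.
rewrite gtn_eqF ?mulr0 ?mul0rn//.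
exact: leq_ltn_trans (ltn_ord j : (j <= n)%N) ni.
Qed.

Lemma signrB (R : pzRingType) (m n : nat) :
  (n <= m)%N -> (-1) ^+ (m - n) = (-1) ^+ m * (-1) ^+ n :> R.
Proof.
by move=> nm; rewrite -signr_odd oddB// signr_addb !signr_odd.
Qed.

Lemma coef_krawtchouk_le (R : realType) (N r m : nat) :
  (r <= N)%N -> (m <= r)%N ->
  (krawtchouk_poly R N r)`_m = (-1) ^+ m * 'C(r, m)%:R *
    hyp2F1 (- N%:R + r%:R) (- m%:R) (r%:R - m%:R + 1) (-1).
Proof.
move=> rN mr.
have -> : - N%:R + r%:R = - (N - r)%:R :> R by rewrite natrB// opprB addrC.
rewrite -natrB// hyp2F1C -(bin_sub mr) -mulrA.
have := bin_hyp2F1 R m (N - r) (r - m); rewrite subnKC// => ->.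
rewrite /krawtchouk_poly (exprDn 1 'X) mulr_sumr coef_sum mulr_sumr.
apply: eq_bigr => k _; rewrite expr1n mul1r (mulrnAr _ 'X^k) coefMn coefMXn.
have -> : (1 - 'X : {poly R}) = 1 + (-1) *: 'X by rewrite scaleN1r.
(* The sum runs to k = N - r, possibly past m; there X^k contributes nothing to X^m, and the
   binomial vanishes since r - m + k > r. *)
rewrite coef_1DcX_exp; have [mk|km] := ltnP m k.
  by rewrite (_ : 'C(r, r - m + k) = 0%N) ?mulr0 ?mul0rn// bin_small//; lia.
have -> : 'C(r, r - m + k) = 'C(r, m - k).
  by rewrite -[RHS]bin_sub; [congr 'C(_, _); lia | lia].
by rewrite signrB// -mulr_natr; ring.
Qed.

Lemma coef_krawtchouk_ge (R : realType) (N r m : nat) :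
  (r <= m)%N -> (m <= N)%N ->
  (krawtchouk_poly R N r)`_m = (-1) ^+ r * 'C(N - r, m - r)%:R *
    hyp2F1 (- N%:R + m%:R) (- r%:R) (m%:R - r%:R + 1) (-1).
Proof.
move=> rm mN.
have -> : - N%:R + m%:R = - (N - m)%:R :> R by rewrite natrB// opprB addrC.
rewrite -natrB// -mulrA.
have := bin_hyp2F1 R (N - m) r (m - r).
have -> : (N - m + (m - r) = N - r)%N by lia.
(* With -X put first, the k-th term carries (-X)^(r - k), so the other factor is read at m - r + k,
   as in the series, without reindexing. *)
move=> ->; rewrite /krawtchouk_poly [1 - 'X]addrC exprDn mulr_suml coef_sum.
rewrite mulr_sumr; apply: eq_bigr => k _.
have kr : (k <= r)%N by rewrite -ltnS.
have -> : (1 + 'X : {poly R}) = 1 + 1 *: 'X by rewrite scale1r.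
rewrite expr1n mulr1 mulrnAl coefMn -['X]scale1r -scaleNr exprZn scale1r.
rewrite -scalerAl coefZ coefXnM coef_1DcX_exp expr1n mul1r ltnNge leq_subLR.
have -> : (r <= k + m)%N by lia.
have -> : (m - (r - k) = m - r + k)%N by lia.
by rewrite /= signrB// -mulr_natr; ring.
Qed.

(** * The matrix as a differential operator *)

Lemma A0_mul_coef (R : realType) (N : nat) (p : {poly R}) :
  (size p <= N.+1)%N ->
  A0 R N *m (\col_(i < N.+1) p`_i) =
  \col_(i < N.+1) ((1 - 'X^2) * p^`() + N%:R * ('X - 1) * p)`_i.
Proof.
move=> sp; apply/matrixP => k j; rewrite !mxE.
have {}sp : p`_N.+1 = 0 by rewrite nth_default.
(* The three branches exclude each other, so they may be added; each sum then has at most one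
   nonzero term. *)
transitivity (\sum_(l < N.+1) (
   (if (l : nat) == k then - N%:R * p`_l else 0) +
   (if (l : nat) == k.+1 then (l : nat)%:R * p`_l else 0) +
   (if (k : nat) == l.+1 then (N%:R - (l : nat)%:R) * p`_l else 0))).
  apply: eq_bigr => l _; rewrite !mxE ![_ == (l : nat)]eq_sym.
  have [->|lk] := eqVneq (l : nat) k.
    by rewrite !ltn_eqF// !addr0.
  have [->|lk'] := eqVneq (l : nat) k.+1.
    by rewrite add0r (ltn_eqF (_ : k < k.+2)%N)// addr0.
  by case: ifP; rewrite !add0r// mul0r.
rewrite !big_split/= -!big_mkcond/=.
rewrite (big_ord1_eq _ (fun l => - N%:R * p`_l)) ltn_ord.
rewrite (big_ord1_eq _ (fun l => l%:R * p`_l)) /= ltnS.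
(* The last row has no superdiagonal entry; the degree bound makes the missing term 0. *)
have -> : (if (k < N)%N then k.+1%:R * p`_k.+1 else 0) = k.+1%:R * p`_k.+1.
  case: ltnP => // Nk; have -> : (k : nat) = N by have := ltn_ord k; lia.
  by rewrite sp mulr0.
rewrite mulrBl mul1r coefD coefB coef_deriv coefXnM.
rewrite -mulrA (mulr_natl (('X - 1) * p)) coefMn mulrBl mul1r coefB coefXM.
case: k => [[|k] kN] /=.
  rewrite big1; last by case.
  ring.
under eq_bigl => i do rewrite eqSS eq_sym.
rewrite (big_ord1_eq _ (fun l => (N%:R - l%:R) * p`_l)) (ltnW kN).
(* In row 1 the product X^2 p' contributes 0, so it is separated from the generic rows. *)
case: k kN => [|k] kN /=; rewrite ?coef_deriv ?subSS ?subn0.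
  by ring.
ring.
Qed.

Theorem theorem2 (R : realType) (N : nat) (hN : (1 <= N)%N) :
  spectrum (map_mx (real_complex R) (A0 R N)) =
    [set z : R[i] | exists2 r : nat, (r <= N)%N & z = - (2%:R * r%:R)] /\
  (forall r : nat, (r <= N)%N ->
    exists v : 'cV[R]_N.+1,
      [/\ forall m : 'I_N.+1, (m <= r)%N ->
            v m 0 = (-1) ^+ m * 'C(r, m)%:R *
                    hyp2F1 (- N%:R + r%:R) (- m%:R) (r%:R - m%:R + 1) (-1),
          forall m : 'I_N.+1, (r <= m)%N ->
            v m 0 = (-1) ^+ r * 'C(N - r, m - r)%:R *
                    hyp2F1 (- N%:R + m%:R) (- r%:R) (m%:R - r%:R + 1) (-1),
          v != 0 &
          A0 R N *m v = - (2%:R * r%:R) *: v]).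
Proof.
pose v r : 'cV[R]_N.+1 := \col_(i < N.+1) (krawtchouk_poly R N r)`_i.
have v0 r : v r != 0.
  (* Entry 0 is the value of the polynomial at 0, namely 1. *)
  apply/negP => /eqP/matrixP/(_ 0 0)/eqP; rewrite !mxE -horner_coef0.
  by rewrite /krawtchouk_poly !hornerE subr0 !expr1n mulr1 oner_eq0.
have Av r : (r <= N)%N -> A0 R N *m v r = - (2%:R * r%:R) *: v r.
  move=> rN; rewrite A0_mul_coef ?size_krawtchouk_poly// krawtchouk_poly_ode//.
  apply/matrixP => i j; rewrite !mxE.
  rewrite -!natrM !mulNr coefN (mulr_natl (krawtchouk_poly R N r)) coefMn.
  by rewrite mulr_natl.
split; last first.
  move=> r rN; exists (v r); split => //; last exact: Av.
  - by move=> m mr; rewrite mxE coef_krawtchouk_le.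
  - by move=> m rm; rewrite mxE coef_krawtchouk_ge// -ltnS.
pose s : seq R[i] := [seq - (2%:R * r%:R) | r <- iota 0 N.+1].
have us : uniq s.
  rewrite map_inj_uniq ?iota_uniq// => i j /oppr_inj.
  move/(mulfI (_ : 2%:R != 0)); rewrite pnatr_eq0 => /(_ isT)/eqP.
  by rewrite eqr_nat => /eqP.
have es : all (eigenvalue (map_mx (real_complex R) (A0 R N))) s.
  apply/allP => x /mapP[r]; rewrite mem_iota ltnS => /andP[_ rN] ->.
  (* Seen as the image of a real number, the eigenvalue can be certified by the real eigenvector. *)
  have -> : - (2%:R * r%:R) = real_complex R (- (2%:R * r%:R)).
    by rewrite rmorphN rmorphM !rmorph_nat.
  by rewrite eigenvalue_map; exact: eigenvalue_col (v0 r) (Av r rN).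
apply/seteqP; split => z; rewrite /spectrum /=.
  rewrite (eigenvalue_uniq_seq _ us es) ?size_map ?size_iota// => /mapP[r].
  by rewrite mem_iota ltnS => /andP[_ rN] ->; exists r.
move=> [r rN ->]; apply: (allP es); apply/mapP; exists r => //.
by rewrite mem_iota.
Qed.
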